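(* Let $M_1$ and $M_2$ be two $\Gamma$-semigroups, let $T: M_1 \to \mathcal{P}^*(M_2)$ be a set-valued anti-homomorphism, and let $B$ be a bi-ideal of $M_2$. Then: (i) $\overline{T}(B)$ is a bi-ideal of $M_1$, if $T(x)\neq\emptyset$ for all $x\in M_1$ and $\overline{T}(B)\neq\emptyset$; (ii) $\underline{T}(B)$ is a bi-ideal of $M_1$, if $\underline{T}(B)\neq\emptyset$ and $T$ is a strong set-valued anti-homomorphism.
   Context: For non-empty sets $M$ and $\Gamma$, $M$ is a $\Gamma$-semigroup if there is a map $M\times\Gamma\times M\to M$, $(a,\alpha,b)\mapsto a\alpha b$, with $(a\alpha b)\beta c = a\alpha(b\beta c)$ for all $a,b,c\in M$, $\alpha,\beta\in\Gamma$. Both $M_1$ and $M_2$ are $\Gamma$-semigroups for the same set $\Gamma$. For subsets $A,B$ of a $\Gamma$-semigroup and $\alpha\in\Gamma$, $A\alpha B=\{a\alpha b : a\in A, b\in B\}$ and $A\Gamma B=\{a\gamma b : a\in A, b\in B,\gamma\in\Gamma\}$. $\mathcal{P}^*(M_2)$ is the set of all non-empty subsets of $M_2$. A map $T:M_1\to\mathcal{P}^*(M_2)$ is a set-valued anti-homomorphism if $T(a\alpha b)\supseteq T(b)\alpha T(a)$ for all $a,b\in M_1$, $\alpha\in\Gamma$; it is a strong set-valued anti-homomorphism if $T(a\alpha b)=T(b)\alpha T(a)$ for all $a,b\in M_1$, $\alpha\in\Gamma$. For $G\subseteq M_2$, $\underline{T}(G)=\{x\in M_1 : T(x)\subseteq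 G\}$ and $\overline{T}(G)=\{x\in M_1 : T(x)\cap G\neq\emptyset\}$. A non-empty subset $S$ of a $\Gamma$-semigroup $M$ is a sub-$\Gamma$-semigroup of $M$ if $S\Gamma S\subseteq S$. A non-empty subset $B$ of $M$ is a bi-ideal of $M$ if $B$ is a sub-$\Gamma$-semigroup of $M$ and $B\Gamma M\Gamma B\subseteq B$. *)

(* Defs.v *)
From mathcomp Require Import all_boot.
From mathcomp Require Import classical_sets.

Set Implicit Arguments.
Unset Strict Implicit.
Unset Printing Implicit Defensive.

Local Open Scope classical_set_scope.

Record gammaSemigroup (Gamma : Type) := GammaSemigroup {
  gs_sort :> Type;
  gs_mul : gs_sort -> Gamma -> gs_sort -> gs_sort;
  gs_mulA : forall (a b c : gs_sort) (alpha beta : Gamma),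
    gs_mul (gs_mul a alpha b) beta c = gs_mul a alpha (gs_mul b beta c);
  gs_nonempty : inhabited gs_sort;
  gs_index_nonempty : inhabited Gamma
}.

Definition set_mul (Gamma : Type) (M : gammaSemigroup Gamma)
    (A : set M) (alpha : Gamma) (B : set M) : set M :=
  [set gs_mul a alpha b | a in A & b in B].

Definition set_Gmul (Gamma : Type) (M : gammaSemigroup Gamma)
    (A B : set M) : set M :=
  [set x | exists a b gamma, [/\ A a, B b & x = gs_mul a gamma b]].

Record pstar (M : Type) := Pstar {
  pstar_set :> set M;
  pstar_nonempty : pstar_set !=set0
}.

Definition set_valued_antihom (Gamma : Type) (M1 M2 : gammaSemigroup Gamma)
    (T : M1 -> pstar M2) : Prop :=
  forall (a b : M1) (alpha : Gamma),
    set_mul (T b) alpha (T a) `<=` T (gs_mul a alpha b).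

Definition strong_set_valued_antihom (Gamma : Type)
    (M1 M2 : gammaSemigroup Gamma) (T : M1 -> pstar M2) : Prop :=
  forall (a b : M1) (alpha : Gamma),
    T (gs_mul a alpha b) = set_mul (T b) alpha (T a) :> set M2.

Definition lower_approx (M1 M2 : Type) (T : M1 -> pstar M2) (G : set M2) :
    set M1 :=
  [set x | T x `<=` G].

Definition upper_approx (M1 M2 : Type) (T : M1 -> pstar M2) (G : set M2) :
    set M1 :=
  [set x | T x `&` G !=set0].

Definition sub_gamma_semigroup (Gamma : Type) (M : gammaSemigroup Gamma)
    (S : set M) : Prop :=
  S !=set0 /\ set_Gmul S S `<=` S.

(* B Gamma M Gamma B is bracketed to the left; by [gs_mulA] this is immaterial. *)
Definition bi_ideal (Gamma : Type) (M : gammaSemigroup Gamma)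
    (B : set M) : Prop :=
  [/\ B !=set0, sub_gamma_semigroup B &
      set_Gmul (set_Gmul B [set: M]) B `<=` B].

(* Main.v *)
Require Import Defs.
From mathcomp Require Import all_boot.
From mathcomp Require Import classical_sets.

Local Open Scope classical_set_scope.

(** [T] reverses products, but the closure conditions of a bi-ideal are symmetric under reversal.
    For the upper approximation, the inclusion puts a reversed product of chosen images into [T] of
    the product, and [B] absorbs it. For the lower one, every element of [T] of the product must lie
    in [B]; equality factors each such element into images. *)

Lemma bi_ideal_mul (Gamma : Type) (M : gammaSemigroup Gamma) (B : set M)
    (a b : M) (g : Gamma) :
  bi_ideal B -> B a -> B b -> B (gs_mul a g b).
Proof. by case=> _ [_ BB] _ Ba Bb; apply: BB; exists a, b, g. Qed.

(** Bracketed to the right because [T] turns the left-bracketed [(a g m) d b] into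
    [b' d (m' g a')]. *)
Lemma bi_ideal_sandwich (Gamma : Type) (M : gammaSemigroup Gamma) (B : set M)
    (a m b : M) (g d : Gamma) :
  bi_ideal B -> B a -> B b -> B (gs_mul a g (gs_mul m d b)).
Proof.
case=> _ _ BMB Ba Bb; apply: BMB; exists (gs_mul a g m), b, d.
by split=> //; [exists a, m, g | rewrite gs_mulA].
Qed.

Lemma bi_ideal_upper_approx (Gamma : Type) (M1 M2 : gammaSemigroup Gamma)
    (T : M1 -> pstar M2) (B : set M2) :
  set_valued_antihom T -> bi_ideal B -> upper_approx T B !=set0 ->
  bi_ideal (upper_approx T B).
Proof.
move=> hT hB T0.
split=> //; first split=> //.
- move=> _ [a [b [g [[a' [Ta Ba]] [b' [Tb Bb]] ->]]]].
  exists (gs_mul b' g a'); split; last exact: bi_ideal_mul.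
  by apply: hT; exists b' => //; exists a'.
- move=> _ [_ [b [d [[a [m [g [[a' [Ta Ba]] _ ->]]]] [b' [Tb Bb]] ->]]]].
  (* The middle factor [m] is arbitrary in [M1], so any element of [T m] serves as the filling
     between [b'] and [a']. *)
  have [m' Tm] := pstar_nonempty (T m).
  exists (gs_mul b' d (gs_mul m' g a')); split; last exact: bi_ideal_sandwich.
  apply: (hT); exists b' => //; exists (gs_mul m' g a') => //.
  by apply: hT; exists m' => //; exists a'.
Qed.

Lemma bi_ideal_lower_approx (Gamma : Type) (M1 M2 : gammaSemigroup Gamma)
    (T : M1 -> pstar M2) (B : set M2) :
  strong_set_valued_antihom T -> bi_ideal B -> lower_approx T B !=set0 ->
  bi_ideal (lower_approx T B).
Proof.
move=> hT hB T0.
split=> //; first split=> //.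
- move=> _ [a [b [g [Ta Tb ->]]]] y; rewrite hT => -[b' Tb' [a' Ta' <-]].
  by apply: bi_ideal_mul; [| apply: Tb | apply: Ta].
- move=> _ [_ [b [d [[a [m [g [Ta _ ->]]]] Tb ->]]]] y.
  (* Equality is applied twice: first to split off [b'], then to split [z], an element of
     [T (gs_mul a g m)], into [m'] and [a']. *)
  rewrite hT => -[b' Tb' [z + <-]]; rewrite hT => -[m' _ [a' Ta' <-]].
  by apply: bi_ideal_sandwich; [| apply: Tb | apply: Ta].
Qed.

Theorem theorem5p4 (Gamma : Type) (M1 M2 : gammaSemigroup Gamma)
    (T : M1 -> pstar M2) (hT : set_valued_antihom T)
    (B : set M2) (hB : bi_ideal B) :
  ((forall x : M1, T x !=set0) -> upper_approx T B !=set0 ->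
     bi_ideal (upper_approx T B)) /\
  (lower_approx T B !=set0 -> strong_set_valued_antihom T ->
     bi_ideal (lower_approx T B)).
Proof.
split=> [_ T0 | T0 hS]; first exact: bi_ideal_upper_approx.
exact: bi_ideal_lower_approx.
Qed.
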